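(* Let $0<k\le 1$ be a constant. For every instance of ROLDARP-B in which every request has revenue $1$ and every edge weight lies in $[kT/f,\,T/f]$, $$\mathrm{rev}(\mathrm{OPT})\le \lceil 1/k\rceil\cdot \mathrm{rev}(\mathrm{SBP})+\lceil 1/k\rceil.$$
   Context: ROLDARP-B: an instance consists of a complete bipartite graph $G=(V_1\cup V_2,E)$ with positive edge weights (travel times), an origin $o\in V_2$ adjacent to all nodes of $V_1$, a time limit $T>0$, an integer $f$ with $1<f<T$, and a sequence of requests $(s,d,t,p)$ with source $s\in V_1$, destination $d\in V_2$, release time $t\ge0$ and revenue $p>0$, each revealed to the online algorithm at its release time. A unit-capacity server starts at $o$ at time $0$ and moves along edges; serving a request means travelling to $s$ and then from $s$ to $d$, leaving $s$ no earlier than $t$; at most one request is carried at a time, service is non-preemptive, and revenue $p$ is earned if the request is completed by time $T$. $\mathrm{OPT}$ is an optimal offline schedule; $\mathrm{rev}(\cdot)$ denotes total revenue earned. Time is split into $f$ segments $t_1,\dots,t_f$ of length $T/f$ ($t_j$ ends at $jT/f$). Algorithm SBP: if $f$ is odd it idles during $t_1$ and sets $i=2$, else $i=1$; while $i<f$, at the start of $t_i$ it computes, among released unserved requests, a maximum-total-revenue sequence of requests that can be served consecutively within time $T/f$ starting at the source of the first one; if non-empty it moves to that source during $t_i$ and serves the sequence during $t_{i+1}$, otherwise it idles during $t_i,t_{i+1}$; then $i$ increases by $2$. *)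

(* Defs.v *)
From HB Require Import structures.
From mathcomp Require Import all_boot all_order all_algebra.
From mathcomp Require Import reals.

Set Implicit Arguments.
Unset Strict Implicit.
Unset Printing Implicit Defensive.

Import Order.TTheory GRing.Theory Num.Theory.

Local Open Scope ring_scope.

Record request (R : realType) (V1 V2 : finType) := Request {
  source : V1;
  dest : V2;
  release : R;
  revenue : R
}.

(* The graph is complete bipartite on [V1 + V2]; [weight u v] is the travel time
   of the undirected edge {u, v}.  Requests are indexed, so that two requests
   with the same data remain distinct. *)
Record instance (R : realType) := Instance {
  V1 : finType;
  V2 : finType;
  weight : V1 -> V2 -> R;
  origin : V2;
  limit : R;
  nseg : nat;
  nreq : nat;
  req : 'I_nreq -> request R V1 V2;
  weight_gt0 : forall u v, 0 < weight u v;
  limit_gt0 : 0 < limit;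
  nseg_gt1 : (1 < nseg)%N;
  nseg_lt_limit : nseg%:R < limit;
  release_ge0 : forall r, 0 <= release (req r);
  revenue_gt0 : forall r, 0 < revenue (req r)
}.

Definition node (R : realType) (I : instance R) : Type := (V1 I + V2 I)%type.

Definition seglen (R : realType) (I : instance R) : R :=
  limit I / (nseg I)%:R.

Definition travel_time (R : realType) (I : instance R) (x y : node I) :
    option R :=
  match x, y with
  | inl u, inr v => Some (weight u v)
  | inr v, inl u => Some (weight u v)
  | _, _ => None
  end.

Inductive action (R : realType) (I : instance R) :=
| Wait of R
| Move of node I
| Pick of 'I_(nreq I)
| Drop.

(* [completed] only records the requests delivered no later than [limit I]. *)
Record state (R : realType) (I : instance R) := State {
  pos : node I;
  clock : R;
  load : option 'I_(nreq I);
  completed : {set 'I_(nreq I)}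
}.

Definition init (R : realType) (I : instance R) : state I :=
  State (inr (origin I)) 0 None set0.

(* The effect of an action, or [None] if it is illegal.  A request can be
   unloaded only at its destination (no preemption), and picking one up requires
   an empty server (unit capacity). *)
Definition step (R : realType) (I : instance R) (s : state I) (a : action I) :
    option (state I) :=
  match a with
  | Wait d =>
      if 0 <= d then Some (State (pos s) (clock s + d) (load s) (completed s))
      else None
  | Move y =>
      if travel_time (pos s) y is Some c
      then Some (State y (clock s + c) (load s) (completed s))
      else None
  | Pick r =>
      if [&& load s == None, r \notin completed s,
             pos s == inl (source (req r)) & release (req r) <= clock s]
      then Some (State (pos s) (clock s) (Some r) (completed s))
      else None
  | Drop =>
      if load s is Some r then
        if pos s == inr (dest (req r)) then
          Some (State (pos s) (clock s) None
                  (if clock s <= limit I then r |: completed s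
                   else completed s))
        else None
      else None
  end.

Fixpoint run (R : realType) (I : instance R) (s : state I)
    (p : seq (action I)) : option (state I) :=
  if p is a :: p' then
    if step s a is Some s' then run s' p' else None
  else Some s.

Definition feasible (R : realType) (I : instance R) (p : seq (action I)) :
    Prop :=
  exists s, run (init I) p = Some s.

(* Total revenue of a schedule; the value 0 in the infeasible case is junk. *)
Definition total_revenue (R : realType) (I : instance R) (p : seq (action I)) :
    R :=
  if run (init I) p is Some s
  then \sum_(r in completed s) revenue (req r) else 0.

Definition is_OPT (R : realType) (I : instance R) (p : seq (action I)) : Prop :=
  feasible p /\ (forall q : seq (action I),
                  feasible q -> total_revenue q <= total_revenue p).

Definition walk (R : realType) (I : instance R) (ys : seq (node I)) :
    seq (action I) :=
  [seq Move y | y <- ys].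

(* [service_plan q p]: [p] serves the requests of [q] one after the other, in
   the order of [q], without waiting. *)
Inductive service_plan (R : realType) (I : instance R) :
    seq 'I_(nreq I) -> seq (action I) -> Prop :=
| service_nil : service_plan [::] [::]
| service_cons r q ys zs p :
    service_plan q p ->
    service_plan (r :: q) (walk ys ++ Pick r :: walk zs ++ Drop I :: p).

(* The sequences from which SBP chooses when a segment starts in state [s]: the
   requests are released and unserved in [s], and they can be served during the
   next segment, the server being at the source of the first one when that
   segment starts. *)
Definition candidate (R : realType) (I : instance R) (s : state I)
    (q : seq 'I_(nreq I)) : Prop :=
  [/\ uniq q,
      forall r, r \in q ->
        release (req r) <= clock s /\ r \notin completed s
    & forall r q', q = r :: q' ->
        exists p s',
          [/\ service_plan q p,
              run (State (inl (source (req r))) (clock s + seglen I) None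
                     (completed s)) p = Some s'
            & clock s' <= clock s + seglen I + seglen I]].

Definition best_sequence (R : realType) (I : instance R) (s : state I)
    (q : seq 'I_(nreq I)) : Prop :=
  candidate s q /\
  (forall q' : seq 'I_(nreq I), candidate s q' ->
     \sum_(r <- q') revenue (req r) <= \sum_(r <- q) revenue (req r)).

(* [SBP_round s p s']: one iteration of the loop of SBP, started in [s], may
   perform the actions [p] and end in [s'] two segments later.  Ties between
   best sequences, and the choice of routes, are left open. *)
Inductive SBP_round (R : realType) (I : instance R) (s : state I) :
    seq (action I) -> state I -> Prop :=
| SBP_idle s' :
    best_sequence s [::] ->
    run s [:: Wait I (seglen I); Wait I (seglen I)] = Some s' ->
    SBP_round s [:: Wait I (seglen I); Wait I (seglen I)] s'
| SBP_serve r q ys d1 p d2 s1 s' :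
    best_sequence s (r :: q) ->
    run s (rcons (walk ys) (Wait I d1)) = Some s1 ->
    pos s1 = inl (source (req r)) ->
    clock s1 = clock s + seglen I ->
    service_plan (r :: q) p ->
    run s1 (rcons p (Wait I d2)) = Some s' ->
    clock s' = clock s1 + seglen I ->
    SBP_round s (rcons (walk ys) (Wait I d1) ++ rcons p (Wait I d2)) s'.

(* [SBP_loop i s p]: from the start of segment [i] (numbered from 1) in state
   [s], the remaining iterations of SBP may perform the actions [p]. *)
Inductive SBP_loop (R : realType) (I : instance R) :
    nat -> state I -> seq (action I) -> Prop :=
| SBP_stop i s : (nseg I <= i)%N -> SBP_loop i s [::]
| SBP_iter i s p s' p' :
    (i < nseg I)%N ->
    SBP_round s p s' ->
    SBP_loop i.+2 s' p' ->
    SBP_loop i s (p ++ p').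

Definition is_SBP (R : realType) (I : instance R) (p : seq (action I)) : Prop :=
  if odd (nseg I) then
    exists s p',
      [/\ run (init I) [:: Wait I (seglen I)] = Some s,
          SBP_loop 2 s p'
        & p = Wait I (seglen I) :: p']
  else SBP_loop 1 (init I) p.

(* Main.v *)
Require Import Defs.
From HB Require Import structures.
From mathcomp Require Import all_boot all_order all_algebra.
From mathcomp Require Import reals.
From mathcomp Require Import zify lra.

Set Implicit Arguments.
Unset Strict Implicit.
Unset Printing Implicit Defensive.

Import Order.TTheory GRing.Theory Num.Theory.

Local Open Scope ring_scope.

(** Write [L] for the segment length and [K] for the ceiling of [1 / k].  The
    graph is bipartite, so the [n]-th delivery of a request released at time
    [a] or later takes place no earlier than [a + (2n - 1) k L]; hence at most
    [K (M + 1)] such requests are served by any schedule when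
    [limit - a <= 2 L (M + 1)].  A round of SBP that is not idle serves at least
    one request, and an idle round starting at time [a] certifies that SBP has
    already served every request released by [a].  Take for [a] the start of the
    last idle round (or [0] if there is none) and for [M] the number of rounds
    after it: if [c] requests were served by SBP before [a], then SBP serves at
    least [c + M] requests and OPT at most [c + K (M + 1)]. *)

(** * Monotonicity of runs *)

Section Runs.
Variables (R : realType) (I : instance R).
Implicit Types (s : state I) (p : seq (action I)) (r : 'I_(nreq I)).

Lemma run_cat s p1 p2 :
  run s (p1 ++ p2) = if run s p1 is Some s' then run s' p2 else None.
Proof. by elim: p1 s => //= a p1 IH s; case: (step s a). Qed.

Lemma step_clock_le s a s' : step s a = Some s' -> clock s <= clock s'.
Proof.
case: a => [d|y|r|] /=.
- by case: ifP => // d0 [<-] /=; rewrite lerDl.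
- case: (pos s) y => [u|v] [u'|v'] //= [<-] /=;
    by rewrite lerDl ltW // weight_gt0.
- by case: ifP => // _ [<-].
- by case: (load s) => // r; case: ifP => // _ [<-].
Qed.

Lemma run_clock_le p s s' : run s p = Some s' -> clock s <= clock s'.
Proof.
elim: p s => [s [<-] //|a p IH s /=].
case E: (step s a) => [s1|] // /IH; exact: le_trans (step_clock_le E).
Qed.

Lemma step_completed_sub s a s' :
  step s a = Some s' -> completed s \subset completed s'.
Proof.
case: a => [d|y|r|] /=.
- by case: ifP => // _ [<-].
- by case: travel_time => // c [<-].
- by case: ifP => // _ [<-].
- case: (load s) => // r; case: ifP => // _ [<-] /=.
  by case: ifP => // _; exact: subsetUr.
Qed.

Lemma run_completed_sub p s s' :
  run s p = Some s' -> completed s \subset completed s'.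
Proof.
elim: p s => [s [<-] //|a p IH s /=].
case E: (step s a) => [s1|] // /IH; exact: subset_trans (step_completed_sub E).
Qed.

Lemma run_walk_load ys s s' : run s (walk ys) = Some s' -> load s' = load s.
Proof.
elim: ys s => [s [<-] //|y ys IH s /=].
by case: travel_time => // c /IH.
Qed.

(** A drop after the limit goes unrecorded; since clocks never decrease, bounding the final clock
    puts the first drop in time. *)
Lemma service_plan_completed r q p s s' :
    service_plan (r :: q) p -> run s p = Some s' -> clock s' <= limit I ->
  r \in completed s'.
Proof.
move=> Hp; inversion Hp as [|r0 q0 ys zs p0 _ E1 E2]; subst.
rewrite run_cat; case: (run s (walk ys)) => [s1|] //=.
case: ifP => // _; rewrite run_cat.
case Ez: (run _ (walk zs)) => [s2|] //=.
rewrite (run_walk_load Ez) /=; case: ifP => // _ Hrun Hlim.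
have := run_clock_le Hrun; rewrite /= => /le_trans/(_ Hlim) lim2.
by apply: (subsetP (run_completed_sub Hrun)); rewrite /= lim2 setU11.
Qed.

End Runs.

(** * Lower bounds on delivery times in an arbitrary schedule *)

Section Deliveries.
Variables (R : realType) (I : instance R) (w a : R).
Hypotheses (w_gt0 : 0 < w) (w_le : forall u v, w <= weight (i := I) u v).
Implicit Types (s : state I) (p : seq (action I)).

Definition released_from : {set 'I_(nreq I)} :=
  [set r | a <= release (req r)].

Definition late_served s : nat := #|completed s :&: released_from|.

Definition on_source_side s : bool := if pos s is inl _ then true else false.

(* A further edge has been crossed since the last delivery when the server is
   in [V1], and one since the last pick-up when a loaded server is in [V2]. *)
Record delivery_invariant s : Prop := DeliveryInvariant {
  delivery_limit : (0 < late_served s)%N ->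
    a + ((late_served s)%:R *+ 2 - 1) * w <= limit I;
  delivery_clock : (0 < late_served s)%N ->
    a + ((late_served s)%:R *+ 2 - (~~ on_source_side s)%:R) * w <= clock s;
  delivery_load : forall r, load s = Some r -> r \in released_from ->
    a + ((late_served s)%:R *+ 2 + (~~ on_source_side s)%:R) * w <= clock s
}.

(** Crossing an edge takes at least [w] and flips the side, which raises either coefficient by at
    most one. A pick-up in [V1] turns the clock bound into the load bound, and a drop in [V2] turns
    it back. *)
Lemma delivery_invariant_step s b s' :
  delivery_invariant s -> step s b = Some s' -> delivery_invariant s'.
Proof.
have w0 := w_gt0; case=> Hlim Hclk Hload; case: b => [d|y|r|] /=.
- case: ifP => // d0 [<-]; split=> //=.
  + by move=> /Hclk /le_trans; apply; rewrite lerDl.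
  + by move=> r /Hload H /H /le_trans; apply; rewrite lerDl.
- case Et: travel_time => [c|] // [<-].
  have [wc side] : w <= c /\
      on_source_side (State y (clock s + c) (load s) (completed s)) =
        ~~ on_source_side s.
    rewrite /on_source_side /=; move: Et.
    by case: (pos s) y => [u|v] [u'|v'] //= [<-].
  split=> //; rewrite side /late_served /= -/(late_served s).
  + move=> /Hclk; case: (on_source_side s); rewrite /= ?subr0; lra.
  + move=> r /Hload H /H; case: (on_source_side s); rewrite /= ?addr0; lra.
- case: ifP => // /and4P[_ _ /eqP Epos rel] [<-].
  split=> //= r' [<-]; rewrite inE => ar.
  rewrite /late_served /= -/(late_served s).
  move: Hclk; rewrite /on_source_side /= Epos /=.
  (* Before any late delivery the bound is just [a], and it comes from the release time of the
     request picked up. *)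
  case: (posnP (late_served s)) => [-> _|n0 /(_ isT)]; first nra.
  by rewrite subr0 addr0.
- case El: (load s) => [r|] //; case: ifP => // /eqP Epos [<-].
  case: ifP => [clim|_]; last by split.
  have := Hload r El.
  set t := State _ _ _ _.
  have side : on_source_side t = on_source_side s by [].
  have sideF : on_source_side s = false by rewrite /on_source_side Epos.
  have [rA /(_ isT)|rA _] := boolP (r \in released_from); last first.
    have En : late_served t = late_served s.
      congr #|pred_of_set _|; apply/setP=> x; rewrite !inE.
      case: eqP => [->|//]; move: rA; rewrite inE => /negbTE ->.
      by rewrite !andbF.
    by split; rewrite ?En ?side.
  (* The coefficient [2n + 1] of the load bound is [2(n + 1) - 1], the one required after the next
     delivery. *)
  have : (late_served t <= (late_served s).+1)%N.
    rewrite /late_served /= setIUl.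
    apply: leq_trans (leq_card_setU _ _) _; rewrite -add1n leq_add2r.
    by rewrite -(cards1 r) subset_leq_card // subsetIl.
  rewrite sideF -(ler_nat R) -natr1 /= => Hn Hc.
  have Hd : a + ((late_served t)%:R *+ 2 - 1) * w <= clock s.
    by apply: le_trans Hc; rewrite lerD2l ler_wpM2r ?(ltW w_gt0) //; lra.
  split=> //= _; last by rewrite side sideF.
  exact: le_trans clim.
Qed.

Lemma delivery_invariant_run p s s' :
  delivery_invariant s -> run s p = Some s' -> delivery_invariant s'.
Proof.
elim: p s => [s Hs [<-] //|b p IH s Hs /=].
by case E: (step s b) => [s1|] //; apply: IH; exact: delivery_invariant_step E.
Qed.

Lemma late_served_le p s : run (init I) p = Some s ->
  (0 < late_served s)%N ->
  a + ((late_served s)%:R *+ 2 - 1) * w <= limit I.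
Proof.
move=> Hrun; suff: delivery_invariant s by case.
apply: delivery_invariant_run Hrun.
by split; rewrite /late_served /= ?set0I ?cards0.
Qed.

End Deliveries.

(** * Progress of SBP, round by round *)

Section SegmentedPlanning.
Variables (R : realType) (I : instance R).
Hypotheses (unit_revenue : forall r : 'I_(nreq I), revenue (req r) = 1)
  (weight_le : forall u v, weight (i := I) u v <= seglen I).
Implicit Types (s : state I) (p : seq (action I)).

Lemma seglen_gt0 : 0 < seglen I.
Proof.
by rewrite divr_gt0 ?limit_gt0 // ltr0n (leq_trans _ (nseg_gt1 I)).
Qed.

Lemma nseg_seglen : (nseg I)%:R * seglen I = limit I.
Proof.
by rewrite mulrC divfK // pnatr_eq0 -lt0n (leq_trans _ (nseg_gt1 I)).
Qed.

(** Otherwise the singleton [[:: r]] would be a candidate of revenue 1, as its single edge fits into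
    one segment. *)
Lemma idle_all_served s r : best_sequence s [::] ->
  release (req r) <= clock s -> r \in completed s.
Proof.
case=> _ best rel; apply/negPn/negP => rC.
suff /best : candidate s [:: r].
  by rewrite big_nil big_seq1 unit_revenue leNgt ltr01.
have L0 := seglen_gt0.
split=> // [x|x q [<- _]]; first by rewrite inE => /eqP ->.
exists (walk [::] ++ Defs.Pick r :: walk [:: inr (dest (req r))] ++ [:: Drop I]).
eexists; split.
- by constructor; constructor.
- have rel' : release (req r) <= clock s + seglen I by lra.
  by rewrite /= rC rel' eqxx /= eqxx.
- by rewrite /= lerD2l.
Qed.

(** Strict progress comes from the first request of the chosen sequence: it is unserved in [s] and
    delivered before the limit. *)
Lemma SBP_round_spec s p s' : SBP_round s p s' ->
    clock s + seglen I *+ 2 <= limit I ->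
  [/\ run s p = Some s', clock s' = clock s + seglen I *+ 2
    & (#|completed s| < #|completed s'|)%N \/
      forall r, release (req r) <= clock s -> r \in completed s].
Proof.
have L0 := seglen_gt0.
case=> [{}s' best Hrun _|r q ys d1 p0 d2 s1 {}s' [[_ cand _] _] H1 _ Hc1 Hp H2
  Hc2 lim].
  split=> //.
    by move: Hrun; rewrite /= (ltW L0) => -[<-] /=; lra.
  by right=> r; exact: idle_all_served.
have Hc : clock s' = clock s + seglen I *+ 2 by rewrite Hc2 Hc1; lra.
have Hrun :
    run s (rcons (walk ys) (Wait I d1) ++ rcons p0 (Wait I d2)) = Some s'.
  by rewrite run_cat H1.
split=> //; left; apply: proper_card; apply/properP.
split; first exact: run_completed_sub Hrun.
exists r; last by have [] := cand r (mem_head _ _).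
move: H2; rewrite -cats1 run_cat; case E: (run s1 p0) => [s2|] // H2.
apply: (subsetP (run_completed_sub H2)).
apply: service_plan_completed Hp E _.
by rewrite (le_trans (run_clock_le H2)) // Hc.
Qed.

(* [M] counts the rounds after the last idle round, which starts at time [a]
   with the set [C] of requests served; the first alternative is that no round
   is idle. *)
Lemma SBP_loop_spec i s p : SBP_loop i s p ->
    odd i != odd (nseg I) -> clock s + seglen I = i%:R * seglen I ->
    (i <= (nseg I).+1)%N ->
  exists s', run s p = Some s' /\ exists M : nat,
    (limit I - clock s <= M%:R * seglen I *+ 2 /\
       (#|completed s| + M <= #|completed s'|)%N) \/
    (exists a (C : {set 'I_(nreq I)}),
      [/\ limit I - a <= (M.+1)%:R * seglen I *+ 2,
          (#|C| + M <= #|completed s'|)%N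
        & forall r, release (req r) <= a -> r \in C]).
Proof.
elim=> {i s p} [i s fi par Hc iF|i s p s' p' fi Hround _ IH par Hc _].
  exists s; split=> //; exists 0%N; left; split; last by rewrite addn0.
  (* Parity excludes [i = nseg I], so the last round ends exactly at the limit. *)
  have Ei : i = (nseg I).+1 by move: par; lia.
  by move: Hc; rewrite Ei -natr1 mulrDl nseg_seglen; lra.
have lim : clock s + seglen I *+ 2 <= limit I.
  have := seglen_gt0; rewrite -nseg_seglen.
  by move: fi; rewrite -(ler_nat R) -natr1; nra.
have [Hrun Hc' Hserve] := SBP_round_spec Hround lim.
have [|||sf [Hrun' [M HM]]] := IH.
- by rewrite /= negbK.
- by rewrite Hc' -(addn2 i) natrD; lra.
- by move: par fi; lia.
exists sf; split; first by rewrite run_cat Hrun.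
case: HM => [[HM HC]|[a [C HC]]]; last by exists M; right; exists a, C.
case: Hserve => [lt|all_served].
  exists M.+1; left; rewrite -natr1; split; first by lra.
  by lia.
(* This is the last idle round; its own two segments account for the [+ 1] in [M.+1]. *)
exists M; right; exists (clock s), (completed s); split=> //.
- by rewrite -natr1; lra.
- apply: leq_trans HC; rewrite leq_add2r subset_leq_card //.
  exact: run_completed_sub Hrun.
Qed.

(** The strict inequality on releases lets [a = 0] with [C] empty cover the case without idle
    rounds. *)
Definition backlog_bound s : Prop :=
  exists (M : nat) (a : R) (C : {set 'I_(nreq I)}),
    [/\ limit I - a <= (M.+1)%:R * seglen I *+ 2,
        (#|C| + M <= #|completed s|)%N
      & forall r, release (req r) < a -> r \in C].

(** The prefix [q] is empty for an even number of segments and the initial wait for an odd one. *)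
Lemma SBP_loop_backlog_bound i s q p :
    run (init I) q = Some s -> SBP_loop i s p ->
    clock s <= seglen I -> clock s + seglen I = i%:R * seglen I ->
    odd i != odd (nseg I) -> (i <= (nseg I).+1)%N ->
  exists s', run (init I) (q ++ p) = Some s' /\ backlog_bound s'.
Proof.
have L0 := seglen_gt0 => Hrun Hloop Hle Hc par iF.
have [sf [Hrun' [M HM]]] := SBP_loop_spec Hloop par Hc iF.
exists sf; split; first by rewrite run_cat Hrun.
exists M; case: HM => [[HM HC]|[a [C [Ha HC Hall]]]]; last first.
  by exists a, C; split=> // r /ltW /Hall.
(* The initial wait, at most one segment, is absorbed by the spare round in [M.+1]. *)
exists 0, set0; split.
- by rewrite -natr1; lra.
- by rewrite cards0 (leq_trans _ HC) // leq_addl.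
- by move=> r; rewrite ltNge release_ge0.
Qed.

Lemma is_SBP_backlog_bound p : is_SBP p ->
  exists s, run (init I) p = Some s /\ backlog_bound s.
Proof.
have L0 := seglen_gt0; have f1 := nseg_gt1 I; rewrite /is_SBP.
case: ifP => [fodd [s [p' [Hrun Hloop ->]]]|feven Hloop].
  have Hc : clock s = seglen I.
    by move: Hrun; rewrite /= (ltW L0) => -[<-] /=; rewrite add0r.
  apply: (SBP_loop_backlog_bound Hrun Hloop); rewrite ?Hc //.
  - by lra.
  - by rewrite fodd.
  - by lia.
apply: (SBP_loop_backlog_bound (q := [::]) _ Hloop) => //=.
- exact: ltW.
- by lra.
- by rewrite feven.
Qed.

Lemma total_revenue_card p s : run (init I) p = Some s ->
  total_revenue p = #|completed s|%:R.
Proof.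
move=> Hrun; rewrite /total_revenue Hrun.
by rewrite (eq_bigr (fun=> 1)) ?sumr_const // => r _; rewrite unit_revenue.
Qed.

End SegmentedPlanning.

(** * Comparison of OPT with SBP *)

Theorem theorem6 (R : realType) (k : R) (k_gt0 : 0 < k) (k_le1 : k <= 1)
    (I : instance R)
    (unit_revenue : forall r : 'I_(nreq I), revenue (req r) = 1)
    (weight_bounds : forall (u : V1 I) (v : V2 I),
       k * limit I / (nseg I)%:R <= weight u v <= limit I / (nseg I)%:R)
    (opt sbp : seq (action I)) (opt_OPT : is_OPT opt) (sbp_SBP : is_SBP sbp) :
  total_revenue opt <=
    (Num.ceil (1 / k))%:~R * total_revenue sbp + (Num.ceil (1 / k))%:~R.
Proof.
have weight_le (u : V1 I) (v : V2 I) : weight u v <= seglen I.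
  by have /andP[] := weight_bounds u v.
have w_le (u : V1 I) (v : V2 I) : k * seglen I <= weight u v.
  by have /andP[] := weight_bounds u v; rewrite /seglen mulrA.
have L0 := seglen_gt0 I.
have w_gt0 : 0 < k * seglen I by rewrite mulr_gt0.
have [[so Hopt] _] := opt_OPT.
have [ss [Hsbp [M [a [C [Ha HC Hall]]]]]] :=
  is_SBP_backlog_bound unit_revenue weight_le sbp_SBP.
rewrite (total_revenue_card unit_revenue Hopt).
rewrite (total_revenue_card unit_revenue Hsbp).
have kV : 1 / k <= (Num.ceil (1 / k))%:~R by exact: ceil_ge.
have : 0 < Num.ceil (1 / k) by rewrite ceil_gt0 divr_gt0.
move: kV; case: (Num.ceil (1 / k)) => // K; rewrite -pmulrn ltz_nat => kV K0.
rewrite -natrM -natrD ler_nat.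
set n := late_served a so.
have n_le : (n <= K * M.+1)%N.
  have [->//|n0] := posnP n.
  have := late_served_le w_gt0 w_le Hopt n0; rewrite -/n => Hn.
  have {}Hn : (n%:R *+ 2 - 1) * k <= M.+1%:R *+ 2 :> R.
    by rewrite -(ler_pM2r L0); move: Hn Ha; lra.
  have {}Hn : n%:R *+ 2 - 1 <= (K * M.+1)%:R *+ 2 :> R.
    rewrite -(ler_pdivlMr _ _ k_gt0) in Hn.
    apply: le_trans Hn _; rewrite natrM -mulrnAr mulrC -div1r.
    by rewrite ler_wpM2r // mulrn_wge0.
  (* Over the integers, the excess of 1 disappears on halving. *)
  have : (n * 2 <= (K * M.+1) * 2 + 1)%N.
    by rewrite -(ler_nat R) natrD !natrM; move: Hn; rewrite natrM; lra.
  by lia.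
have opt_le : (#|completed so| <= #|C| + n)%N.
  rewrite -(cardsID (released_from I a)) addnC leq_add2r subset_leq_card //.
  by apply/subsetP => r; rewrite !inE -ltNge => /andP[/Hall].
(* Since [K >= 1], [c + K(M + 1) <= K(c + M) + K] with [c] the size of [C]. *)
nia.
Qed.
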